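(* The LP-relaxation of the integer programming formulation $\mathcal{F}_2$ of the iTTP is strictly stronger than the LP-relaxation of the formulation $\mathcal{F}_1$. That is, writing $\mathrm{LP}_{\mathcal{F}}(I)$ for the optimal objective value of the LP-relaxation of formulation $\mathcal{F}$ on instance $I$ (equal to $+\infty$ if infeasible): (1) for every iTTP instance $I$, $\mathrm{LP}_{\mathcal{F}_2}(I)\ge \mathrm{LP}_{\mathcal{F}_1}(I)$; and (2) there exists an iTTP instance $I$ with $\mathrm{LP}_{\mathcal{F}_2}(I)> \mathrm{LP}_{\mathcal{F}_1}(I)$.
   Context: An instance of the incomplete Traveling Tournament Problem (iTTP) consists of a set of teams $T=\{1,\dots,n\}$ with $n$ even, a set of rounds $R=\{1,\dots,r\}$ with $r\ge 2$ even and $r\le n-2$, a matrix of non-negative distances $(d_{ij})_{i,j\in T}$ with $d_{ii}=0$, and an integer $\lambda\ge 1$. The problem asks for a timetable of home/away matches in which each team plays exactly one game per round, exactly $r/2$ home and $r/2$ away games, at most $\lambda$ consecutive home and at most $\lambda$ consecutive away games, any two teams meet at most once, and the total travel distance is minimized. For an integer $s$ let $R_s=\{1,\dots,s\}$ (empty if $s\le 0$). The LP-relaxation of a formulation is obtained by replacing every constraint ''variable $\in\{0,1\}$'' by ''variable $\in[0,1]$''. **Formulation $\mathcal{F}_1$.** Variables $x_{ijs}\in\{0,1\}$ for $i\ne j\in T$, $s\in R$ (team $i$ plays home against $j$ in round $s$), with the convention $x_{iis}=0$, and $y_{tij}\in\{0,1\}$ for $t,i,j\in T$ (team $t$ travels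 from the venue of $i$ to the venue of $j$). Minimize $\sum_{t\in T}\sum_{i\in T}\sum_{j\in T} d_{ij}y_{tij}$ subject to - $\sum_{s\in R}(x_{ijs}+x_{jis})\le 1$ for all $i<j$ in $T$; - $\sum_{j\in T\setminus\{i\}}(x_{ijs}+x_{jis})=1$ for all $i\in T$, $s\in R$; - $\sum_{j\in T\setminus\{i\}}\sum_{s\in R}x_{ijs}=\frac r2$ for all $i\in T$; - $x_{i,t,s-1}+x_{j,t,s}-1\le y_{tij}$ for all $i,j,t\in T$, $s\in R\setminus\{1\}$; - $x_{i,t,s-1}+\sum_{j\in T\setminus\{i\}}x_{t,j,s}-1\le y_{tit}$ for all $i,t\in T$, $s\in R\setminus\{1\}$; - $\sum_{j\in T\setminus\{i\}}x_{t,j,s-1}+x_{i,t,s}-1\le y_{tti}$ for all $i,t\in T$, $s\in R\setminus\{1\}$; - $x_{i,t,1}\le y_{tti}$ for all $i,t\in T$; - $x_{i,t,r}\le y_{tit}$ for all $i,t\in T$; - $\sum_{f=s}^{s+\lambda}\sum_{j\in T\setminus\{i\}}x_{jif}\le\lambda$ for all $i\in T$, $s\in R_{r-\lambda}$; - $\sum_{f=s}^{s+\lambda}\sum_{j\in T\setminus\{i\}}x_{jif}\ge 1$ for all $i\in T$, $s\in R_{r-\lambda}$. **Formulation $\mathcal{F}_2$.** For $t\in T$, let $P_t$ be the set of all possible road trips of $t$, i.e. all sequences $p=(p_1,\dots,p_k)$ of distinct teams in $T\setminus\{t\}$ with $1\le k\le\lambda$. For such $p$ put $\delta_{tp}=k$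 (its length) and $c_{tp}=d_{t,p_1}+\sum_{l=1}^{k-1}d_{p_l,p_{l+1}}+d_{p_k,t}$ (its travel distance), and let $\tau_{tp}=r-\delta_{tp}+1$ be the latest round in which $t$ can start $p$. Write $i\in p$ if $i$ occurs in $p$. Define $$A_{ts}=\{(p,q): p\in P_t,\ q\in R_{\tau_{tp}},\ q\le s<q+\delta_{tp}\}\quad(t\in T,\ s\in R),$$ $$V_{its}=\{(p,q): p\in P_i,\ t\in p,\ q\in R_{\tau_{ip}},\ q\le s<q+\delta_{ip},\ p_{s-q+1}=t\}\quad(i\ne t\in T,\ s\in R).$$ So $V_{its}$ collects the pairs (trip, start round) for which team $i$ visits team $t$ in round $s$. Variables $z_{tps}\in\{0,1\}$ for $t\in T$, $p\in P_t$, $s\in R_{\tau_{tp}}$ (team $t$ starts trip $p$ in round $s$). Minimize $\sum_{t\in T}\sum_{p\in P_t}\sum_{s\in R_{\tau_{tp}}}c_{tp}z_{tps}$ subject to - $\sum_{p\in P_t}\sum_{s\in R_{\tau_{tp}}}\delta_{tp}z_{tps}=\frac r2$ for all $t\in T$; - $\sum_{s\in R}\bigl(\sum_{(p,q)\in V_{tis}}z_{tpq}+\sum_{(p,q)\in V_{its}}z_{ipq}\bigr)\le 1$ for all $t<i$ in $T$; - $\sum_{(p,q)\in A_{t,s-1}}z_{tpq}+\sum_{p\in P_t:\, s\le\tau_{tp}}z_{tps}\le 1$ for all $t\in T$, $s\in R\setminus\{1\}$; - $\sum_{(p,q)\in A_{ts}}z_{tpq}+\sum_{i\in T\setminus\{t\}}\sum_{(p,q)\in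 V_{its}}z_{ipq}=1$ for all $t\in T$, $s\in R$; - $\sum_{f=s}^{s+\lambda}\sum_{i\in T\setminus\{t\}}\sum_{(p,q)\in V_{itf}}z_{ipq}\le\lambda$ for all $t\in T$, $s\in R_{r-\lambda}$. *)

(* Defs.v *)
From mathcomp Require Import all_boot all_order all_algebra.
From mathcomp Require Import classical_sets reals constructive_ereal ereal.

Set Implicit Arguments.
Unset Strict Implicit.
Unset Printing Implicit Defensive.

Import Order.TTheory GRing.Theory Num.Theory.
Local Open Scope classical_set_scope.
Local Open Scope ring_scope.

(* Teams are the elements of 'I_n. Rounds are natural numbers, numbered from  *)
(* 1 to r; values of the round-indexed variables outside this range occur     *)
(* neither in the constraints nor in the objectives.                          *)
Record ittp (R : realType) : Type := ITTP {
  nteams : nat;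
  nrounds : nat;
  dist : 'M[R]_nteams;
  lam : nat;
  nteams_even : ~~ odd nteams;
  nrounds_even : ~~ odd nrounds;
  nrounds_ge2 : (2 <= nrounds)%N;
  nrounds_le : (nrounds <= nteams - 2)%N;
  dist_ge0 : forall i j, 0 <= dist i j;
  dist_diag : forall i, dist i i = 0;
  lam_ge1 : (1 <= lam)%N
}.

Definition team (R : realType) (I : ittp R) : finType := 'I_(nteams I).

(* A formulation is parameterized by the set dom in which each of its         *)
(* variables ranges: the integer program has dom = binary, its LP-relaxation  *)
(* has dom = unit_interval.                                                   *)
Definition binary (R : realType) : set R := [set v | v = 0 \/ v = 1].
Definition unit_interval (R : realType) : set R := [set v | 0 <= v <= 1].

(* Formulation F1: x i j s means that i plays at home against j in round s,   *)
(* y t i j that t travels from the venue of i to the venue of j.              *)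

Definition F1_cost (R : realType) (I : ittp R)
    (y : team I -> team I -> team I -> R) : R :=
  \sum_(t : team I) \sum_(i : team I) \sum_(j : team I) dist I i j * y t i j.

Record F1_feasible (R : realType) (I : ittp R) (dom : set R)
    (x : team I -> team I -> nat -> R)
    (y : team I -> team I -> team I -> R) : Prop := {
  F1_x_dom : forall (i j : team I) (s : nat), i != j ->
    (1 <= s <= nrounds I)%N -> dom (x i j s);
  F1_x_diag : forall (i : team I) (s : nat),
    (1 <= s <= nrounds I)%N -> x i i s = 0;
  F1_y_dom : forall t i j : team I, dom (y t i j);
  F1_meet_once : forall i j : team I, (i < j)%N ->
    \sum_(1 <= s < (nrounds I).+1) (x i j s + x j i s) <= 1;
  F1_one_game : forall (i : team I) (s : nat), (1 <= s <= nrounds I)%N ->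
    \sum_(j : team I | j != i) (x i j s + x j i s) = 1;
  F1_half_home : forall i : team I,
    \sum_(j : team I | j != i) \sum_(1 <= s < (nrounds I).+1) x i j s
      = (nrounds I)%:R / 2;
  F1_away_away : forall (i j t : team I) (s : nat), (1 < s <= nrounds I)%N ->
    x i t s.-1 + x j t s - 1 <= y t i j;
  F1_away_home : forall (i t : team I) (s : nat), (1 < s <= nrounds I)%N ->
    x i t s.-1 + \sum_(j : team I | j != i) x t j s - 1 <= y t i t;
  F1_home_away : forall (i t : team I) (s : nat), (1 < s <= nrounds I)%N ->
    \sum_(j : team I | j != i) x t j s.-1 + x i t s - 1 <= y t t i;
  F1_first_round : forall i t : team I, x i t 1%N <= y t t i;
  F1_last_round : forall i t : team I, x i t (nrounds I) <= y t i t;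
  F1_max_away : forall (i : team I) (s : nat),
    (1 <= s <= nrounds I - lam I)%N ->
    \sum_(s <= f < (s + lam I).+1) \sum_(j : team I | j != i) x j i f
      <= (lam I)%:R;
  F1_max_home : forall (i : team I) (s : nat),
    (1 <= s <= nrounds I - lam I)%N ->
    1 <= \sum_(s <= f < (s + lam I).+1) \sum_(j : team I | j != i) x j i f
}.

(* Formulation F2: z t p s means that t starts the road trip p in round s.    *)

Definition seq_le_lam (R : realType) (I : ittp R) : finType :=
  (lam I).-bseq (team I).

Definition trips (R : realType) (I : ittp R) (t : team I) :
    {set seq_le_lam I} :=
  [set p : seq_le_lam I | [&& (0 < size p)%N, uniq p & t \notin p]].

(* The defaults of head, nth and last are irrelevant on nonempty sequences.   *)
Definition trip_cost (R : realType) (I : ittp R) (t : team I)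
    (p : seq_le_lam I) : R :=
  dist I t (head t p)
  + \sum_(0 <= l < (size p).-1) dist I (nth t p l) (nth t p l.+1)
  + dist I (last t p) t.

(* This is r - size p + 1 when size p <= r, and 0 otherwise, thanks to        *)
(* truncated subtraction.                                                     *)
Definition latest_start (R : realType) (I : ittp R) (p : seq_le_lam I) : nat :=
  ((nrounds I).+1 - size p)%N.

(* Pairs (trip, start round); start rounds lie in {1, .., r}, a subset of     *)
(* 'I_r.+1.                                                                   *)
Definition active (R : realType) (I : ittp R) (t : team I) (s : nat) :
    {set seq_le_lam I * 'I_(nrounds I).+1} :=
  [set pq : seq_le_lam I * 'I_(nrounds I).+1 |
    [&& pq.1 \in trips t,
        (1 <= pq.2 <= latest_start pq.1)%N
      & (pq.2 <= s < pq.2 + size pq.1)%N]].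

(* The entry p_(s - q + 1), counted from 1, is nth _ p (s - q).               *)
Definition visits (R : realType) (I : ittp R) (i t : team I) (s : nat) :
    {set seq_le_lam I * 'I_(nrounds I).+1} :=
  [set pq : seq_le_lam I * 'I_(nrounds I).+1 |
    [&& pq.1 \in trips i,
        t \in pq.1,
        (1 <= pq.2 <= latest_start pq.1)%N,
        (pq.2 <= s < pq.2 + size pq.1)%N
      & nth i pq.1 (s - pq.2) == t]].

Definition F2_cost (R : realType) (I : ittp R)
    (z : team I -> seq_le_lam I -> nat -> R) : R :=
  \sum_(t : team I) \sum_(p in trips t)
    \sum_(1 <= s < (latest_start p).+1) trip_cost t p * z t p s.

Record F2_feasible (R : realType) (I : ittp R) (dom : set R)
    (z : team I -> seq_le_lam I -> nat -> R) : Prop := {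
  F2_z_dom : forall (t : team I) (p : seq_le_lam I) (s : nat),
    p \in trips t -> (1 <= s <= latest_start p)%N -> dom (z t p s);
  F2_half_away : forall t : team I,
    \sum_(p in trips t) \sum_(1 <= s < (latest_start p).+1)
      (size p)%:R * z t p s = (nrounds I)%:R / 2;
  F2_meet_once : forall t i : team I, (t < i)%N ->
    \sum_(1 <= s < (nrounds I).+1)
      (\sum_(pq in visits t i s) z t pq.1 pq.2
       + \sum_(pq in visits i t s) z i pq.1 pq.2) <= 1;
  F2_home_between : forall (t : team I) (s : nat), (1 < s <= nrounds I)%N ->
    \sum_(pq in active t s.-1) z t pq.1 pq.2
    + \sum_(p in trips t | (s <= latest_start p)%N) z t p s <= 1;
  F2_one_game : forall (t : team I) (s : nat), (1 <= s <= nrounds I)%N ->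
    \sum_(pq in active t s) z t pq.1 pq.2
    + \sum_(i : team I | i != t) \sum_(pq in visits i t s) z i pq.1 pq.2 = 1;
  F2_max_home : forall (t : team I) (s : nat),
    (1 <= s <= nrounds I - lam I)%N ->
    \sum_(s <= f < (s + lam I).+1) \sum_(i : team I | i != t)
      \sum_(pq in visits i t f) z i pq.1 pq.2 <= (lam I)%:R
}.

(* Optimal values; the infimum of the empty set is +oo.                       *)

Definition F1_value (R : realType) (dom : set R) (I : ittp R) : \bar R :=
  ereal_inf [set v : \bar R | exists x y,
    @F1_feasible R I dom x y /\ v = (F1_cost y)%:E].

Definition F2_value (R : realType) (dom : set R) (I : ittp R) : \bar R :=
  ereal_inf [set v : \bar R | exists z,
    @F2_feasible R I dom z /\ v = (F2_cost z)%:E].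

Definition LP_F1 (R : realType) (I : ittp R) : \bar R :=
  F1_value (@unit_interval R) I.

Definition LP_F2 (R : realType) (I : ittp R) : \bar R :=
  F2_value (@unit_interval R) I.

(* Main.v *)
(* Part (1): a feasible solution z of the relaxation of F2 induces one of F1, *)
(* with x i j s the mass of the trips during which j visits i in round s, and *)
(* y t i j the mass, truncated at 1, of the legs from i to j on the trips of  *)
(* t; without truncation the two costs agree.  Each linear inequality of F1   *)
(* then reduces to an inequality between counting functions that holds for    *)
(* each single pair (trip, start round).                                      *)
(* Part (2): take n = 4, r = 2, lambda = 1, distinct teams at distance 1.     *)
(* Every trip is a single visit, so F2 costs exactly 2 per team, whereas      *)
(* x = 1/6 allows y to vanish except for the departures in round 1 and the    *)
(* returns after round 2, at a total cost of 1 per team.                      *)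

Require Import Defs.
From mathcomp Require Import all_boot all_order all_algebra.
From mathcomp Require Import classical_sets reals constructive_ereal ereal.
From mathcomp Require Import zify lra.

Set Implicit Arguments.
Unset Strict Implicit.
Unset Printing Implicit Defensive.

Import Order.TTheory GRing.Theory Num.Theory.
Local Open Scope ring_scope.

(** The inequalities of F1 that link consecutive rounds carry a [-1], so small fractional [x] makes
    them void, whereas F2 pays for complete trips. For (1), the sums of F2 are written as
    [mass t f], a combination of values of [z] with nonnegative coefficients, and [le_mass] reduces
    inequalities to a single pair. The [1] of a linking inequality is absorbed by
    [mass_home_between] in [leg_away_away]; when one of the two games is at home, [home_mass_le]
    supplies it, combined with [leg_return] or [leg_departure]. Then [F1_feasible_of_F2] and
    [F1_cost_le_F2] conclude. For (2), [F2_half_away] alone forces cost 8 in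
    [F2_cost_unit_instance], against 4 for [thin_y]. *)

Definition legs (T : Type) (t : T) (p : seq T) : seq (T * T) :=
  zip (t :: p) (rcons p t).

Lemma nth_legs (T : eqType) (t : T) (p : seq T) (k : nat) : (k <= size p)%N ->
  (nth t (t :: p) k, nth t (rcons p t) k) \in legs t p.
Proof.
move=> hk; rewrite -nth_zip /= ?size_rcons//.
by rewrite mem_nth // size_zip /= size_rcons minnn ltnS.
Qed.

Lemma sum_legs (V : nmodType) (T : Type) (d : T -> T -> V) (t : T) (p : seq T) :
  (0 < size p)%N ->
  d t (head t p) + \sum_(0 <= l < (size p).-1) d (nth t p l) (nth t p l.+1)
    + d (last t p) t = \sum_(l <- legs t p) d l.1 l.2.
Proof.
case: p => // a p _; rewrite /legs /= big_cons /= -addrA; congr (_ + _).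
elim: p a => [|b p IH] a /=; first by rewrite big_nil big_seq1 add0r.
rewrite big_nat_recl //= big_cons /= -IH addrA; congr (_ + _ + _).
Qed.

(** Grouping legs by their endpoints brings trip costs into the shape of [F1_cost]. *)
Lemma sum_count_mem (R : comPzRingType) (T : finType) (d : T -> T -> R)
    (s : seq (T * T)) :
  \sum_i \sum_j d i j *+ count_mem (i, j) s = \sum_(l <- s) d l.1 l.2.
Proof.
rewrite pair_big /=; elim: s => [|a s IH].
  by rewrite big_nil big1.
rewrite big_cons -IH [X in X + _](_ : _ = \sum_p d p.1 p.2 *+ (a == p)).
  by rewrite -big_split /=; apply: eq_bigr => -[i j] _ /=; rewrite mulrnDr.
rewrite (bigD1 a) //= eqxx big1 ?addr0 // => p.
by rewrite eq_sym => /negbTE ->.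
Qed.

(** * Sums over trips as masses of counting functions *)

Section TripMass.
Variables (R : realType) (I : ittp R).
Implicit Types (t i j : team I) (pq : seq_le_lam I * 'I_(nrounds I).+1).

Definition starts t : {set seq_le_lam I * 'I_(nrounds I).+1} :=
  [set pq : seq_le_lam I * 'I_(nrounds I).+1 |
    (pq.1 \in trips t) && (1 <= pq.2 <= latest_start pq.1)%N].

(* As constants, these are atoms for [lia], unlike their bodies, which hide   *)
(* canonical structures.                                                      *)
Definition start_round pq : nat := pq.2.
Definition trip_size pq : nat := size pq.1.

Definition is_active (s : nat) pq : bool :=
  (start_round pq <= s < start_round pq + trip_size pq)%N.

Definition leg_count t i j pq : nat := count_mem (i, j) (legs t pq.1).

Definition is_visit t i (s : nat) pq : bool :=
  is_active s pq && (nth t pq.1 (s - start_round pq) == i).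

Variable z : team I -> seq_le_lam I -> nat -> R.

(** Values of [f] are naturals so that indicators (through the coercion from [bool]), lengths and
    leg counts are treated alike. *)
Definition mass t (f : seq_le_lam I * 'I_(nrounds I).+1 -> nat) : R :=
  \sum_(pq in starts t) z t pq.1 pq.2 *+ f pq.

Lemma sum_mem_mass t (A : {set seq_le_lam I * 'I_(nrounds I).+1})
    (P : pred (seq_le_lam I * 'I_(nrounds I).+1)) :
  (forall pq, (pq \in A) = (pq \in starts t) && P pq) ->
  \sum_(pq in A) z t pq.1 pq.2 = mass t P.
Proof.
move=> AP; rewrite /mass (eq_bigl _ _ AP) big_mkcondr.
by apply: eq_bigr => pq _; case: (P pq); rewrite ?mulr1n ?mulr0n.
Qed.

Lemma sum_active t s :
  \sum_(pq in active t s) z t pq.1 pq.2 = mass t (is_active s).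
Proof. by apply: sum_mem_mass => pq; rewrite !inE -!andbA. Qed.

Lemma sum_visits t i s :
  \sum_(pq in visits t i s) z t pq.1 pq.2 = mass t (is_visit t i s).
Proof.
apply: sum_mem_mass => pq; rewrite [in LHS]inE [in RHS]inE /is_visit /is_active.
case: (pq.1 \in trips t) => //=.
case: (1 <= pq.2 <= latest_start pq.1)%N; rewrite ?andbF //=.
rewrite -/(start_round pq) -/(trip_size pq).
case: (boolP (start_round pq <= s < _)%N) => hs; rewrite ?andbF //=.
case: eqP => [<-|]; rewrite ?andbF // andbT.
by apply: (@mem_nth _ t pq.1); rewrite -/(trip_size pq); lia.
Qed.

Lemma sum_starts t (F : seq_le_lam I -> nat -> R) :
  \sum_(p in trips t) \sum_(1 <= s < (latest_start p).+1) F p s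
    = \sum_(pq in starts t) F pq.1 pq.2.
Proof.
rewrite [RHS](eq_bigl (fun pq => (pq.1 \in trips t)
    && (1 <= pq.2 <= latest_start pq.1)%N)); last by move=> pq; rewrite inE.
rewrite -(pair_big_dep (fun p => p \in trips t)
   (fun p (q : 'I_(nrounds I).+1) => 1 <= q <= latest_start p)%N (fun p q => F p q)).
apply: eq_bigr => p; rewrite inE => /and3P[p0 _ _].
(* A trip is nonempty, so its latest start is at most r and fits in the ordinal type. *)
have hl : ((latest_start p).+1 <= (nrounds I).+1)%N by rewrite /latest_start; lia.
rewrite (big_nat_widen _ _ _ _ _ hl) (big_nat_widenl _ 0) // big_mkord.
by apply: eq_bigl => q /=; lia.
Qed.

Lemma sum_start_at t s : (1 <= s <= nrounds I)%N ->
  \sum_(p in trips t | (s <= latest_start p)%N) z t p s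
    = mass t (fun pq => (s == start_round pq)).
Proof.
move=> hs; rewrite /mass.
rewrite -(sum_starts _ (fun p q => z t p q *+ (s == q))) big_mkcondr.
apply: eq_bigr => p _; case: ifP => hp.
  rewrite (@bigD1_seq _ _ _ _ _ s) ?iota_uniq //= ?mem_index_iota; last lia.
  rewrite eqxx big1 ?addr0 // => q.
  by rewrite eq_sym => /negbTE ->.
rewrite big_nat big1 // => q hq.
by case: eqP => // e; move: hq hp; rewrite -e; lia.
Qed.

Lemma mass_add t f g : mass t (fun pq => f pq + g pq)%N = mass t f + mass t g.
Proof. by rewrite -big_split; apply: eq_bigr => pq _; rewrite mulrnDr. Qed.

Lemma mass_sum (K : Type) (r : seq K) (P : pred K) t f :
  \sum_(k <- r | P k) mass t (f k) = mass t (fun pq => \sum_(k <- r | P k) f k pq)%N.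
Proof.
by rewrite exchange_big; apply: eq_bigr => pq _; rewrite sumrMnr.
Qed.

Lemma eq_mass t f g : {in starts t, f =1 g} -> mass t f = mass t g.
Proof. by move=> fg; apply: eq_bigr => pq /fg ->. Qed.

Lemma starts_bounds t pq : pq \in starts t ->
  [/\ (0 < trip_size pq <= lam I)%N, (0 < start_round pq)%N
    & (start_round pq + trip_size pq <= (nrounds I).+1)%N].
Proof.
rewrite !inE /latest_start -/(start_round pq) -/(trip_size pq).
move=> /andP[/and3P[h0 _ _] h1].
by split; rewrite ?h0 /trip_size ?size_bseq // -/(trip_size pq); lia.
Qed.

Lemma starts_notin t pq : pq \in starts t -> t \notin pq.1.
Proof. by rewrite !inE => /andP[/and3P[]]. Qed.

(** During an active round the index is in range, so [nth] returns a genuine stop rather than its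
    default [t], and a trip of [t] avoids [t]. *)
Lemma mass_visit_self t s : mass t (is_visit t t s) = 0.
Proof.
rewrite /mass big1 // => pq /starts_notin tp.
suff /negbTE -> : ~~ is_visit t t s pq by [].
apply: contra tp => /andP[/andP[h1 h2] /eqP h].
by rewrite -[X in X \in _]h (@mem_nth _ t pq.1) // -/(trip_size pq); lia.
Qed.

(** An active trip is at exactly one venue in round [s]. *)
Lemma sum_mass_visit t s :
  \sum_(i | i != t) mass t (is_visit t i s) = mass t (is_active s).
Proof.
transitivity (\sum_i mass t (is_visit t i s)).
  by rewrite [RHS](bigD1 t) //= mass_visit_self add0r.
rewrite mass_sum; apply: eq_mass => pq _.
rewrite (bigD1 (nth t pq.1 (s - start_round pq))) //= /is_visit eqxx andbT big1 ?addn0 //.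
by move=> i; rewrite eq_sym => /negbTE ->; rewrite andbF.
Qed.

Lemma sum_mass_active t :
  \sum_(1 <= s < (nrounds I).+1) mass t (is_active s)
    = mass t trip_size.
Proof.
rewrite mass_sum; apply: eq_mass => pq /starts_bounds[_ h0 h1].
(* Split the rounds before, during and after the trip; only the middle block contributes, one per
   stop. *)
rewrite /is_active (@big_cat_nat _ _ _ (start_round pq)) /=; [|lia|lia].
rewrite [X in (_ + X)%N](@big_cat_nat _ _ _ (start_round pq + trip_size pq)) /=;
  [|lia|lia].
rewrite [X in (X + _)%N]big_nat [X in (X + _)%N]big1; last by move=> s; lia.
rewrite [X in (_ + (_ + X))%N]big_nat [X in (_ + (_ + X))%N]big1; last by move=> s; lia.
rewrite big_nat (eq_bigr (fun=> 1%N)); last by move=> s ->.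
by rewrite -big_nat sum_nat_const_nat; lia.
Qed.

Lemma F2_cost_mass :
  F2_cost z = \sum_t \sum_i \sum_j
    dist I i j * mass t (leg_count t i j).
Proof.
apply: eq_bigr => t _; rewrite (sum_starts _ (fun p s => trip_cost t p * z t p s)).
transitivity (\sum_(pq in starts t) \sum_i \sum_j
    (dist I i j *+ count_mem (i, j) (legs t pq.1)) * z t pq.1 pq.2).
  apply: eq_bigr => pq /starts_bounds[/andP[p0 _] _ _].
  rewrite /trip_cost sum_legs // -(sum_count_mem (fun i j => dist I i j)).
  by rewrite mulr_suml; apply: eq_bigr => i _; rewrite mulr_suml.
rewrite exchange_big; apply: eq_bigr => i _.
rewrite exchange_big; apply: eq_bigr => j _.
by rewrite mulr_sumr; apply: eq_bigr => pq _; rewrite mulrnAr mulrnAl.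
Qed.

(** * Consequences of feasibility for F2 *)

Hypothesis z_feas : F2_feasible (@unit_interval R) z.

Lemma starts_ge0 t pq : pq \in starts t -> 0 <= z t pq.1 pq.2.
Proof. by rewrite inE => /andP[hp hq]; case/andP: (F2_z_dom z_feas hp hq). Qed.

Lemma mass_ge0 t f : 0 <= mass t f.
Proof. by apply: sumr_ge0 => pq /starts_ge0 ?; rewrite mulrn_wge0. Qed.

Lemma le_mass t f g : {in starts t, forall pq, (f pq <= g pq)%N} ->
  mass t f <= mass t g.
Proof.
move=> fg; apply: ler_sum => pq h.
exact: ler_wpMn2l (starts_ge0 h) _ _ (fg _ h).
Qed.

Lemma mass_one_game t s : (1 <= s <= nrounds I)%N ->
  mass t (is_active s) + \sum_(i | i != t) mass i (is_visit i t s) = 1.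
Proof.
move=> hs; rewrite -(F2_one_game z_feas t hs) sum_active; congr (_ + _).
by apply: eq_bigr => i _; rewrite sum_visits.
Qed.

Lemma mass_active_le1 t s : (1 <= s <= nrounds I)%N -> mass t (is_active s) <= 1.
Proof.
by move=> hs; rewrite -(mass_one_game t hs) lerDl sumr_ge0 // => i _; apply: mass_ge0.
Qed.

Lemma mass_visit_le_active t i s : mass t (is_visit t i s) <= mass t (is_active s).
Proof. by apply: le_mass => pq _; rewrite /is_visit; case: is_active; case: eqP. Qed.

Lemma mass_home_between t s : (1 < s <= nrounds I)%N ->
  mass t (is_active s.-1) + mass t (fun pq => (s == start_round pq)) <= 1.
Proof.
move=> hs; rewrite -(@sum_start_at t s); last lia.
by rewrite -sum_active (F2_home_between z_feas t hs).
Qed.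

Definition visit_mass i t (s : nat) : R := mass t (is_visit t i s).
Definition leg_mass t i j : R := mass t (leg_count t i j).

Lemma visit_mass_le1 i t s : (1 <= s <= nrounds I)%N -> visit_mass i t s <= 1.
Proof.
by move=> hs; apply: le_trans (mass_visit_le_active _ _ _) (mass_active_le1 _ hs).
Qed.

Lemma home_mass t s : (1 <= s <= nrounds I)%N ->
  \sum_(j | j != t) visit_mass t j s = 1 - mass t (is_active s).
Proof. by move=> hs; rewrite -(mass_one_game t hs) addrAC subrr add0r. Qed.

(** F1 excludes [j = i] where [home_mass] excludes [j = t]: the term at [t] vanishes and the one at
    [i] is nonnegative. *)
Lemma home_mass_le t i s : (1 <= s <= nrounds I)%N ->
  \sum_(j | j != i) visit_mass t j s <= 1 - mass t (is_active s).
Proof.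
move=> hs; rewrite -home_mass // big_mkcond [leRHS]big_mkcond /=; apply: ler_sum => j _.
case: (eqVneq j t) => [->|_].
  by rewrite /= {1}/visit_mass mass_visit_self; case: ifP.
by case: ifP => _ //=; apply: mass_ge0.
Qed.

Lemma leg_count_gt0 t i j pq (k : nat) : (k <= trip_size pq)%N ->
  nth t (t :: pq.1) k = i -> nth t (rcons pq.1 t) k = j ->
  (0 < leg_count t i j pq)%N.
Proof. by move=> hk <- <-; rewrite -has_count has_pred1 nth_legs. Qed.

(** With [1] replaced by the masses active in round [s.-1] or starting in round [s], a single trip
    exceeds that bound only by visiting [i] and then [j], hence by using the leg. *)
Lemma leg_away_away i j t s : (1 < s <= nrounds I)%N ->
  visit_mass i t s.-1 + visit_mass j t s - 1 <= leg_mass t i j.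
Proof.
move=> hs; rewrite lerBlDr; apply: le_trans (lerD (lexx _) (mass_home_between t hs)).
rewrite /visit_mass /leg_mass -!mass_add; apply: le_mass => pq hpq.
have [hsz h0 h1] := starts_bounds hpq.
rewrite /is_visit; case: (boolP (is_active s pq)) => /= [hact|_]; last first.
  by case: is_active; case: eqP => _ /=; lia.
case: (boolP (is_active s.-1 pq)) => /= [hact'|na]; last first.
  by move: hact na; rewrite /is_active; case: eqP => _ /=; lia.
case: eqP => [hi|_]; last by case: eqP => _; lia.
case: eqP => [hj|_]; last lia.
suff : (0 < leg_count t i j pq)%N by lia.
move: hact hact'; rewrite /is_active => hact hact'.
apply: (@leg_count_gt0 _ _ _ _ (s - start_round pq)).
- lia.
- by rewrite -hi (_ : s - start_round pq = (s.-1 - start_round pq).+1)%N //; lia.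
- by rewrite -hj nth_rcons (_ : _ < _)%N // -/(trip_size pq); lia.
Qed.

(** After visiting [i], a trip either stays active or ends there and returns home. *)
Lemma leg_return i t s : (0 < s)%N ->
  visit_mass i t s <= mass t (is_active s.+1) + leg_mass t i t.
Proof.
move=> hs; rewrite /visit_mass /leg_mass -mass_add; apply: le_mass => pq hpq.
have [hsz h0 h1] := starts_bounds hpq.
rewrite /is_visit; case: (boolP (is_active s pq)) => //= hact.
case: eqP => //= hi.
case: (boolP (is_active s.+1 pq)) => [//|na] /=.
rewrite add0n; move: hact na; rewrite /is_active => hact na.
apply: (@leg_count_gt0 _ _ _ _ (trip_size pq)) => //.
  by rewrite -hi (_ : trip_size pq = (s - start_round pq).+1) //; lia.
by rewrite nth_rcons ltnn eqxx.
Qed.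

Lemma leg_departure i t s :
  visit_mass i t s.+1 <= mass t (is_active s) + leg_mass t t i.
Proof.
rewrite /visit_mass /leg_mass -mass_add; apply: le_mass => pq hpq.
have [hsz h0 h1] := starts_bounds hpq.
rewrite /is_visit; case: (boolP (is_active s.+1 pq)) => //= hact.
case: eqP => //= hi.
case: (boolP (is_active s pq)) => [//|na] /=.
rewrite add0n; move: hact na; rewrite /is_active => hact na.
apply: (@leg_count_gt0 _ _ _ _ 0) => //.
(* Active in round [s.+1] but not in [s], the trip starts in [s.+1], so [i] is its first stop. *)
have e : (s.+1 - start_round pq = 0)%N by lia.
by rewrite -hi e nth_rcons -/(trip_size pq); case/andP: hsz => ->.
Qed.

Lemma mass_inactive t s :
  {in starts t, forall pq, is_active s pq = false} -> mass t (is_active s) = 0.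
Proof. by move=> h; rewrite /mass big1 // => pq /h ->. Qed.

(* A trip active in round s + lambda has started after round s, since its     *)
(* length is at most lambda; hence the last term of the sum is absorbed by    *)
(* the start terms of the constraints [F2_home_between].                      *)
Lemma mass_active_window t s : (1 <= s <= nrounds I - lam I)%N ->
  \sum_(s <= f < (s + lam I).+1) mass t (is_active f) <= (lam I)%:R.
Proof.
move=> hs; have hlam := lam_ge1 I.
rewrite big_nat_recr /=; last lia.
have hlast : mass t (is_active (s + lam I)) <=
    \sum_(s <= f < s + lam I) mass t (fun pq => (f.+1 == start_round pq)).
  rewrite mass_sum; apply: le_mass => pq hpq.
  have [hsz h0 h1] := starts_bounds hpq.
  rewrite /is_active; case: andP => //= -[h2 h3].
  rewrite (@bigD1_seq _ _ _ _ _ (start_round pq).-1) ?iota_uniq //=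
    ?mem_index_iota; last lia.
  by rewrite prednK // eqxx.
apply: le_trans (lerD (lexx _) hlast) _; rewrite -big_split /=.
apply: le_trans (_ : _ <= \sum_(s <= f < s + lam I) 1) _.
  rewrite !big_nat; apply: ler_sum => f hf.
  by have := @mass_home_between t f.+1; apply; lia.
by rewrite sumr_const_nat addKn.
Qed.

Lemma F1_feasible_of_F2 :
  F1_feasible (@unit_interval R) visit_mass
    (fun t i j => Num.min 1 (leg_mass t i j)).
Proof.
have vge0 i t s : 0 <= visit_mass i t s by apply: mass_ge0.
have hr2 := nrounds_ge2 I.
split.
- by move=> i j s _ hs; rewrite /unit_interval /= vge0 visit_mass_le1.
- by move=> i s _; apply: mass_visit_self.
- by move=> t i j; rewrite /unit_interval /= le_min ler01 mass_ge0 ge_min lexx.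
- move=> i j ij; have := F2_meet_once z_feas ij.
  by under eq_bigr => s _ do rewrite !sum_visits addrC.
- move=> i s hs; rewrite big_split /= home_mass // sum_mass_visit.
  by rewrite subrK.
- move=> i; rewrite exchange_big /= big_nat.
  under eq_bigr => s hs do rewrite home_mass //.
  rewrite -big_nat big_split /= sumrN sum_mass_active sumr_const_nat subn1 /=.
  have -> : mass i trip_size = (nrounds I)%:R / 2.
    rewrite -(F2_half_away z_feas i) (sum_starts i (fun p s => (size p)%:R * z i p s)).
    by apply: eq_bigr => pq _; rewrite mulr_natl.
  lra.
- move=> i j t s hs; rewrite le_min leg_away_away // andbT.
  have := @visit_mass_le1 i t s.-1; have := @visit_mass_le1 j t s.
  by move=> /(_ ltac:(lia)) h1 /(_ ltac:(lia)) h2; lra.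
- move=> i t s hs; have hs1 : (0 < s.-1)%N by lia.
  have := leg_return i t hs1; rewrite prednK; last lia.
  have := @visit_mass_le1 i t s.-1 ltac:(lia).
  have := @home_mass_le t i s ltac:(lia).
  have := mass_ge0 t (is_active s).
  by rewrite le_min; lra.
- move=> i t s hs; have := leg_departure i t s.-1; rewrite prednK; last lia.
  have := @visit_mass_le1 i t s ltac:(lia).
  have := @home_mass_le t i s.-1 ltac:(lia).
  have := mass_ge0 t (is_active s.-1).
  by rewrite le_min; lra.
- move=> i t; have := leg_departure i t 0.
  rewrite mass_inactive ?add0r; last first.
    by move=> pq /starts_bounds[_ h0 _]; rewrite /is_active; lia.
  by rewrite le_min => ->; rewrite visit_mass_le1 //; lia.
- move=> i t; have := leg_return i t (ltnW hr2).
  rewrite mass_inactive ?add0r; last first.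
    by move=> pq /starts_bounds[_ _ h1]; rewrite /is_active; lia.
  by rewrite le_min => ->; rewrite visit_mass_le1 //; lia.
- move=> i s hs; under eq_bigr => f _ do rewrite sum_mass_visit.
  exact: mass_active_window.
- move=> i s hs; under eq_bigr => f _ do rewrite sum_mass_visit.
  (* Home and away masses total [lam I + 1] over the window, so a home mass of at most [lam I]
     leaves at least 1 away. *)
  have := F2_max_home z_feas i hs.
  rewrite (eq_big_nat _ _ (F2 := fun f => 1 - mass i (is_active f))); last first.
    move=> f hf; rewrite -(@home_mass i f); last lia.
    by apply: eq_bigr => j _; rewrite sum_visits.
  rewrite big_split /= sumrN sumr_const_nat subSn ?leq_addr //.
  by rewrite addKn -[(lam I).+1]addn1 natrD; lra.
Qed.

Lemma F1_cost_le_F2 :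
  F1_cost (fun t i j => Num.min 1 (leg_mass t i j)) <= F2_cost z.
Proof.
rewrite F2_cost_mass; apply: ler_sum => t _.
apply: ler_sum => i _; apply: ler_sum => j _.
by rewrite ler_wpM2l ?dist_ge0 // ge_min lexx orbT.
Qed.
End TripMass.

Lemma LP_F1_le_F2 (R : realType) (I : ittp R) : (LP_F1 I <= LP_F2 I)%E.
Proof.
apply/ereal_infP => _ [z [hz ->]].
apply: le_trans (_ : _ <= (F1_cost (fun t i j => Num.min 1 (leg_mass z t i j)))%:E)%E _.
  by apply: ereal_inf_lbound; do 2 eexists; split; first exact: F1_feasible_of_F2 hz.
by rewrite lee_fin; apply: F1_cost_le_F2.
Qed.

(** * The separating instance *)

Lemma unit_dist_ge0 (R : realType) (i j : 'I_4) :
  0 <= (\matrix_(i, j) (i != j)%:R : 'M[R]_4) i j.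
Proof. by rewrite mxE ler0n. Qed.

Lemma unit_dist_diag (R : realType) (i : 'I_4) :
  (\matrix_(i, j) (i != j)%:R : 'M[R]_4) i i = 0.
Proof. by rewrite mxE eqxx. Qed.

Definition unit_instance (R : realType) : ittp R :=
  @ITTP R 4 2 (\matrix_(i, j) (i != j)%:R) 1
    isT isT isT isT (@unit_dist_ge0 R) (@unit_dist_diag R) isT.

Lemma F2_cost_unit_instance (R : realType)
    (z : team (unit_instance R) -> seq_le_lam (unit_instance R) -> nat -> R) :
  F2_feasible (@unit_interval R) z -> F2_cost z = 8.
Proof.
move=> hz; transitivity (\sum_(t : team (unit_instance R)) (2 : R)); last first.
  by rewrite sumr_const card_ord /=; lra.
apply: eq_bigr => t _.
have := F2_half_away hz t; rewrite divff ?pnatr_eq0 // => h.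
rewrite -[RHS]mulr1 -[X in _ = _ * X]h mulr_sumr; apply: eq_bigr => p.
rewrite inE => /and3P[p0 _ tp]; rewrite mulr_sumr; apply: eq_bigr => s _.
rewrite mulrA; congr (_ * _).
have [a pa] : exists a, p = [:: a] :> seq _.
  by have := size_bseq p; case: (bseqval p) p0 => [|a [|]] // _ _; exists a.
have ta : t != a by rewrite -mem_seq1 -pa.
rewrite /trip_cost pa big_geq //=.
have at_ : a != t by rewrite eq_sym.
by rewrite !mxE ta at_ /=; lra.
Qed.

(** Three opponents, each at home or away, share one game per round equally: hence 1/6. *)
Definition uniform_x (R : realType) (i j : 'I_4) (s : nat) : R :=
  if i == j then 0 else 6^-1.

(** Only the six legs joining the home of [t] to another venue carry weight, as the first and last
    rounds demand. *)
Definition thin_y (R : realType) (t i j : 'I_4) : R :=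
  if (i != j) && ((t == i) || (t == j)) then 6^-1 else 0.

Lemma sum_other_teams (R : realType) (i : 'I_4) (c : R) :
  \sum_(j | j != i) c = c *+ 3.
Proof. by rewrite sumr_const cardC1 card_ord. Qed.

Lemma F1_feasible_unit_instance (R : realType) :
  @F1_feasible R (unit_instance R) (@unit_interval R)
    (@uniform_x R) (@thin_y R).
Proof.
have x_le (i j : team (unit_instance R)) s : uniform_x R i j s <= 6^-1.
  by rewrite /uniform_x; case: ifP => _; lra.
have row_le (i t : team (unit_instance R)) s :
    \sum_(j | j != i) uniform_x R t j s <= 2^-1.
  apply: le_trans (ler_sum _ (fun j _ => x_le t j s)) _.
  by rewrite sum_other_teams; lra.
have home_sum (i : team (unit_instance R)) s :
    \sum_(j | j != i) uniform_x R i j s = 2^-1.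
  rewrite (eq_bigr (fun=> 6^-1)); last first.
    by move=> j; rewrite /uniform_x eq_sym => /negbTE ->.
  by rewrite sum_other_teams; lra.
have away_sum (i : team (unit_instance R)) s :
    \sum_(j | j != i) uniform_x R j i s = 2^-1.
  by rewrite -(home_sum i s); apply: eq_bigr => j _; rewrite /uniform_x eq_sym.
have y_ge0 (t i j : team (unit_instance R)) : 0 <= thin_y R t i j.
  by rewrite /thin_y; case: ifP => _; lra.
split.
- by move=> i j s /negbTE ij _; rewrite /unit_interval /uniform_x /= ij; lra.
- by move=> i s _; rewrite /uniform_x eqxx.
- by move=> t i j; rewrite /unit_interval /thin_y /=; case: ifP => _; lra.
- move=> i j ij; rewrite big_nat_recr // big_nat1 /=.
  have := x_le i j; have := x_le j i => h1 h2.
  by move: (h1 1%N) (h1 2%N) (h2 1%N) (h2 2%N); lra.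
- by move=> i s _; rewrite big_split /= home_sum away_sum; lra.
- by move=> i; rewrite exchange_big big_nat_recr // big_nat1 /= !home_sum; lra.
(* In this and the next two constraints the left side is negative: at most 1/6 + 1/2 - 1. *)
- move=> i j t s _; apply: le_trans (y_ge0 _ _ _).
  by have := x_le i t s.-1; have := x_le j t s; lra.
- move=> i t s _; apply: le_trans (y_ge0 _ _ _).
  by have := x_le i t s.-1; have := row_le i t s; lra.
- move=> i t s _; apply: le_trans (y_ge0 _ _ _).
  by have := x_le i t s; have := row_le i t s.-1; lra.
- by move=> i t; rewrite /uniform_x /thin_y eqxx /= andbT eq_sym; case: eqP.
- by move=> i t; rewrite /uniform_x /thin_y eqxx orbT andbT; case: eqP.
- move=> i s _; under eq_bigr => f _ do rewrite away_sum.
  by rewrite sumr_const_nat subSn ?leq_addr // addKn /=; lra.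
- move=> i s _; under eq_bigr => f _ do rewrite away_sum.
  by rewrite sumr_const_nat subSn ?leq_addr // addKn /=; lra.
Qed.

Lemma F1_cost_unit_instance (R : realType) :
  F1_cost (I := unit_instance R) (@thin_y R) = 4.
Proof.
by rewrite /F1_cost /team /= !big_ord_recl !big_ord0 !mxE /thin_y /=; lra.
Qed.

Theorem theorem4p1 (R : realType) :
  (forall I : ittp R, (LP_F2 I >= LP_F1 I)%E) /\
  (exists I : ittp R, (LP_F2 I > LP_F1 I)%E).
Proof.
split; first exact: LP_F1_le_F2.
exists (unit_instance R); apply: (@le_lt_trans _ _ 4%:E).
  rewrite -(F1_cost_unit_instance R); apply: ereal_inf_lbound.
  by do 2 eexists; split; first exact: F1_feasible_unit_instance.
apply: (@lt_le_trans _ _ 8%:E); first by rewrite lte_fin ltr_nat.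
by apply/ereal_infP => _ [z [hz ->]]; rewrite F2_cost_unit_instance.
Qed.
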